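(* Let $\mu$ be a regular measure on the closed unit disk $\overline{\mathbb{D}}=\{z:|z|\le 1\}$. Then there exists a subsequence $\mathcal{N}\subseteq\mathbb{N}$ of asymptotic density $1$ such that $$\lim_{\substack{n\to\infty\\ n\in\mathcal{N}}}\frac{z\,p_{n-1}(z;\mu)}{p_n(z;\mu)}=1$$ uniformly on compact subsets of $\overline{\mathbb{C}}\setminus\overline{\mathbb{D}}$.
   Context: $\overline{\mathbb{C}}$ is the Riemann sphere. All measures are positive, finite, compactly supported Borel measures on $\mathbb{C}$ with infinite support. $p_n(z;\mu)=\kappa_n z^n+\cdots$, $\kappa_n>0$, is the degree-$n$ orthonormal polynomial of $\mu$: $\int \overline{p_n}\,p_m\,d\mu=\delta_{nm}$. The measure $\mu$ is called regular if $\lim_{n\to\infty}\kappa_n^{-1/n}=\mathrm{capacity}(\mathrm{supp}(\mu))$ (logarithmic capacity). $\mu$ is regular on $\overline{\mathbb{D}}$ if $\mu$ is regular, $\mathrm{supp}(\mu)\subseteq\overline{\mathbb{D}}$, and the unit circle $\partial\mathbb{D}$ is contained in $\mathrm{supp}(\mu)$. A set $\mathcal{N}\subseteq\mathbb{N}$ has asymptotic density $1$ if $\lim_{n\to\infty}\#(\mathcal{N}\cap\{1,\dots,n\})/n=1$. The quotient is regarded as analytic at $\infty$, with value $\kappa_{n-1}/\kappa_n$ there. *)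

(* Defs.v *)
From HB Require Import structures.
From mathcomp Require Import all_boot all_order all_algebra.
From mathcomp Require Import complex.
From mathcomp Require Import all_classical all_reals all_analysis.

Set Implicit Arguments.
Unset Strict Implicit.
Unset Printing Implicit Defensive.

Import Order.TTheory GRing.Theory Num.Theory.
Import numFieldNormedType.Exports.

Local Open Scope classical_set_scope.
Local Open Scope ring_scope.
Local Open Scope complex_scope.

(* R[i] has no topology in the libraries; it is given the one of the norm. *)
HB.instance Definition _ (R : realType) := NormedModule.copy R[i] R[i]^o.

Notation borelC R := (g_sigma_algebraType (@open R[i])).

(* The Riemann sphere; [Some z] is the finite point z and [None] is infinity. *)
Notation sphere R := (one_point_compactification R[i]).

Section orthogonal_polynomials.
Variable R : realType.
Local Notation C := R[i].
Implicit Types (mu nu : {measure set (borelC R) -> \bar R}) (p : nat -> {poly C}).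

Definition supp mu : set C :=
  [set z | forall U : set C, open U -> U z -> (0 < mu U)%E].

Definition closed_disk : set C := [set z | `|z| <= 1].

Definition unit_circle : set C := [set z | `|z| = 1].

Definition cintegral mu (f : C -> C) : C :=
  (\int[mu]_z complex.Re (f z)) +i* (\int[mu]_z complex.Im (f z)).

(* In R[i], [0 < c] means that c is real and positive. *)
Definition orthonormal_polynomials mu p : Prop :=
  (forall n, size (p n) = n.+1 /\ 0 < lead_coef (p n)) /\
  (forall n m, cintegral mu (fun z => ((p n).[z])^*%C * (p m).[z]) = (n == m)%:R).

Definition kappa p (n : nat) : R := complex.Re (lead_coef (p n)).

(* The kernel is +oo on the diagonal, since [lne 0 = -oo]. *)
Definition log_energy nu : \bar R :=
  (\int[nu]_z \int[nu]_w (- lne (complex.Re `|(z : C) - (w : C)|)%:E))%E.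

(* The logarithmic capacity of a compact set K; it is 0 when every probability
   measure on K has infinite energy. *)
Definition capacity (K : set C) : \bar R :=
  expeR (- ereal_inf
    [set log_energy nu | nu in [set nu : probability (borelC R) R | nu K = 1%E]])%E.

Definition regular_measure mu p : Prop :=
  (fun n => ((kappa p n) `^ (- n%:R^-1))%:E) @ \oo --> capacity (supp mu).

Definition regular_on_closed_disk mu p : Prop :=
  [/\ regular_measure mu p, supp mu `<=` closed_disk & unit_circle `<=` supp mu].

Definition asymptotic_density (N : set nat) (d : R) : Prop :=
  (fun n => (\sum_(1 <= k < n.+1) (k \in N))%N%:R / n%:R) @ \oo --> d.

(* z p_{n-1}(z) / p_n(z), with its value at infinity. For orthonormal p the zeros
   of p_n lie in the convex hull of supp mu, so p_n has no zero off the closed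
   disk when supp mu is contained in it. *)
Definition zpratio p (n : nat) (zeta : sphere R) : C :=
  if zeta is Some z then z * (p n.-1).[z] / (p n).[z]
  else (kappa p n.-1 / kappa p n)%:C.

End orthogonal_polynomials.

Arguments closed_disk : clear implicits.
Arguments unit_circle : clear implicits.

(* Main.v *)
Require Import Defs.
From HB Require Import structures.
From mathcomp Require Import all_boot all_order all_algebra.
From mathcomp Require Import complex.
From mathcomp Require Import all_classical all_reals all_analysis.
From mathcomp Require Import measurable_realfun ring lra.

Import Order.TTheory GRing.Theory Num.Theory.
Import numFieldNormedType.Exports.

Local Open Scope classical_set_scope.
Local Open Scope ring_scope.
Local Open Scope complex_scope.

(** Write a_k = ln (kappa_k / kappa_{k-1}). Since |z| <= 1 mu-almost everywhere,
    multiplication by z does not increase the norm of L^2(mu). Hence a_k >= 0,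
    and the reproducing kernel yields, for |z| > 1 and r = kappa_{n-1} / kappa_n,
      (|z| - 1)^2 |z p_{n-1}(z) / p_n(z) - r|^2 <= 1 - r^2.
    The capacity of supp mu is at least 1, because the uniform measure on the unit
    circle has nonpositive energy; regularity then forces the means of the a_k to
    tend to 0, and a nonnegative sequence whose means tend to 0 tends to 0 along a
    set of density 1. *)

(** The estimate compares the quotient with r, its value at infinity, and depends on z only through
    |z| - 1; hence one bound serves {|z| >= 1 + d} and infinity at once, and no normal families
    enter. Regularity controls only (ln kappa_n - ln kappa_0) / n, the mean of the a_k, so single
    a_k may stay large along a sparse set: this is where density 1 comes from. The analytic obstacle
    is that the potential of the uniform measure has to be at most 0 at every z, also on the circle,
    where the kernel is singular. Evaluating it on finite grids turns a sum of logarithms into the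
    logarithm of one explicit polynomial; rotating each grid keeps that polynomial away from 0. *)

(** * Nonnegative sequences whose means tend to 0 *)

(** Markov's inequality with a moving threshold [s], the square root of a majorant [b] of the means:
    among the indices up to n, the exceptional ones make up a fraction of at most b_n / s_n =
    s_n. *)
Lemma density_one_cvg0 (R : realType) (a : nat -> R) :
  (forall n, 0 <= a n) ->
  (fun n => (\sum_(1 <= k < n.+1) a k) / n%:R) @ \oo --> (0 : R) ->
  exists N : set nat, asymptotic_density N (1 : R) /\ a @ within N \oo --> (0 : R).
Proof.
move=> a0 m0; set m : nat -> R := (fun n => _ / _) in m0.
(* Tail suprema make [b] nonincreasing, so that s_n <= s_k for k <= n; the added 1/(n+1) makes it
   positive, so that s_n can be divided by. *)
pose b n := sups m n + n.+1%:R^-1.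
have mB : bounded_fun m.
  by apply: cvg_seq_bounded; apply/cvg_ex; exists 0; exact: m0.
have mU : has_ubound (range m) by exact: bounded_fun_has_ubound.
have m_ge0 n : 0 <= m n by rewrite /m divr_ge0 // sumr_ge0.
have m_le n : m n <= sups m n.
  apply: ub_le_sup; last by exists n => /=.
  by case: mU => M hM; exists M => _ [k _ <-]; apply: hM; exists k.
have b_gt0 n : 0 < b n.
  by rewrite /b ltr_wpDl ?invr_gt0 ?ltr0n // (le_trans (m_ge0 n)).
have b_dec n k : (n <= k)%N -> b k <= b n.
  move=> nk; rewrite /b lerD ?lef_pV2 ?posrE ?ltr0n ?ler_nat //.
  exact: nonincreasing_sups.
have b0 : b @ \oo --> (0 : R).
  rewrite -[0]addr0; apply: cvgD; first exact: cvg_sups.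
  exact: cvg_harmonic.
pose s n := Num.sqrt (b n).
have s_gt0 n : 0 < s n by rewrite sqrtr_gt0.
have s0 : s @ \oo --> (0 : R).
  rewrite -(sqrtr0 R); apply: (@cvg_comp _ _ _ b Num.sqrt _ _ _ b0).
  exact: sqrt_continuous.
pose N : set nat := [set k | a k <= s k].
exists N; split; last first.
  apply/cvgrPdist_le => e e0.
  move/cvgrPdist_le: s0 => /(_ e e0) s0.
  rewrite /within /= /nbhs /=; apply: (@filterS _ \oo _ _ _ _ s0) => k sk /= ak.
  rewrite sub0r normrN ger0_norm //; apply: (le_trans ak).
  by move: sk; rewrite sub0r normrN (ger0_norm (ltW (s_gt0 k))).
rewrite /asymptotic_density.
set c := (X in X @ \oo --> _).
have cnt n : (\sum_(1 <= k < n.+1) (k \in N) <= n)%N.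
  rewrite -[leqRHS]muln1 -[X in (_ <= X * _)%N](subn1 n.+1) -sum_nat_const_nat.
  by apply: leq_sum => i _; case: (_ \in _).
have c1 : \forall n \near \oo, 1 - s n <= c n <= 1.
  near=> n; have n0 : (0 < n)%N by near: n; exact: nbhs_infty_gt.
  have n0R : 0 < n%:R :> R by rewrite ltr0n.
  rewrite /c ler_pdivrMr // mul1r ler_nat cnt andbT.
  rewrite ler_pdivlMr // mulrBl mul1r lerBlDr -lerBlDl.
  (* Each k <= n outside [N] contributes a_k > s_k >= s_n. *)
  have h : s n * (n%:R - (\sum_(1 <= k < n.+1) (k \in N))%N%:R)
      <= \sum_(1 <= k < n.+1) a k.
    have -> : n%:R = \sum_(1 <= k < n.+1) (1 : R).
      by rewrite sumr_const_nat subn1.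
    rewrite natr_sum -sumrB mulr_sumr big_nat_cond [leRHS]big_nat_cond.
    apply: ler_sum => k /andP[/andP[k0 kn] _].
    case: (boolP (k \in _)) => kN; rewrite ?subrr ?mulr0 // subr0 mulr1.
    have : ~~ (a k <= s k) by apply: contraNN kN => kN; rewrite inE.
    rewrite -ltNge => /ltW; apply: le_trans.
    by rewrite ler_wsqrtr // b_dec.
  rewrite -(ler_pM2l (s_gt0 n)); apply: (le_trans h).
  rewrite mulrA -expr2 sqr_sqrtr ?(ltW (b_gt0 n)) //.
  rewrite -ler_pdivrMr //; apply: (le_trans (m_le n)).
  by rewrite /b lerDl invr_ge0.
apply: (squeeze_cvgr c1); last exact: cvg_cst.
rewrite -[X in _ --> X]subr0; apply: cvgB => //; exact: cvg_cst.
Unshelve. all: by end_near. Qed.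

(** * Orthonormal polynomials for a form contracted by multiplication by X *)

Section orthonormal_sequence.
Local Set Implicit Arguments.
Local Unset Strict Implicit.
Local Open Scope ring_scope.
Variables (C : numClosedFieldType) (ip : {poly C} -> {poly C} -> C).
Hypothesis ipDr : forall f g h, ip f (g + h) = ip f g + ip f h.
Hypothesis ipZr : forall f c g, ip f (c *: g) = c * ip f g.
Hypothesis ipC : forall f g, ip g f = (ip f g)^*.
Hypothesis ip_ge0 : forall f, 0 <= ip f f.
Hypothesis ip_shift : forall f, ip ('X * f) ('X * f) <= ip f f.
Variable p : nat -> {poly C}.
Hypothesis size_p : forall n, size (p n) = n.+1.
Hypothesis lead_p : forall n, 0 < lead_coef (p n).
Hypothesis ip_p : forall n m, ip (p n) (p m) = (n == m)%:R.

Local Notation l n := (lead_coef (p n)).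

Let ipDl f g h : ip (f + g) h = ip f h + ip g h.
Proof. by rewrite ipC ipDr rmorphD /= -!ipC. Qed.

Let ipZl f c g : ip (c *: f) g = c^* * ip f g.
Proof. by rewrite ipC ipZr rmorphM /= -ipC. Qed.

Let ip_sumr I (r : seq I) (F : I -> {poly C}) f :
  ip f (\sum_(i <- r) F i) = \sum_(i <- r) ip f (F i).
Proof. by apply: (big_morph (ip f)) => [x y|]; [exact: ipDr|by rewrite -[0](scale0r 0) ipZr mul0r]. Qed.

Let ip_suml I (r : seq I) (F : I -> {poly C}) f :
  ip (\sum_(i <- r) F i) f = \sum_(i <- r) ip (F i) f.
Proof. by rewrite ipC ip_sumr rmorph_sum; apply: eq_bigr => i _; rewrite /= -ipC. Qed.

Let ipBB f g : ip (f - g) (f - g) = ip f f - ip f g - ip g f + ip g g.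
Proof.
by rewrite -scaleN1r !ipDl !ipDr !ipZl !ipZr rmorphN rmorph1; ring.
Qed.

Let CauchySchwarz_ip f g : 0 < ip f f -> `|ip f g| ^+ 2 <= ip f f * ip g g.
Proof.
move=> f0; have := ip_ge0 (ip f f *: g - ip f g *: f).
rewrite ipBB !ipZl !ipZr (ipC g f) normCK.
rewrite (_ : (ip f f)^* = ip f f) -?ipC // => h.
rewrite -subr_ge0 -(pmulr_rge0 _ f0); move: h; congr (0 <= _); ring.
Qed.

(** Subtracting a multiple of p_n cancels the top coefficient; orthonormality then identifies the
    coefficients. *)
Lemma orthonormal_expansion n (f : {poly C}) : (size f <= n)%N ->
  f = \sum_(j < n) ip (p j) f *: p j.
Proof.
elim: n f => [|n IH] f; first by rewrite leqn0 size_poly_eq0 big_ord0 => /eqP.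
move=> fn; pose c := f`_n / l n; pose g := f - c *: p n.
have l0 : l n != 0 by rewrite gt_eqF.
have gn : (size g <= n)%N.
  apply/leq_sizeP => j; rewrite leq_eqVlt => /orP[/eqP <-|nj].
    rewrite coefB coefZ /c lead_coefE size_p /= divfK ?subrr //.
    by rewrite -[X in _`_X]/(n.+1.-1) -(size_p n) -lead_coefE.
  rewrite coefB coefZ !nth_default ?mulr0 ?subrr ?size_p //.
  exact: leq_trans fn nj.
have fE : f = g + c *: p n by rewrite subrK.
have gE := IH g gn.
have gpn : ip (p n) g = 0.
  rewrite gE ip_sumr big1 // => j _; rewrite ipZr ip_p gtn_eqF ?mulr0 //.
rewrite big_ord_recr /= {1}fE [in LHS]gE; congr (_ + _).
  apply: eq_bigr => j _; congr (_ *: _).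
  by rewrite fE ipDr ipZr ip_p ltn_eqF // mulr0 addr0.
by rewrite fE ipDr gpn ipZr ip_p eqxx mulr1 add0r.
Qed.

Let ip_small n (f : {poly C}) : (size f <= n)%N -> ip (p n) f = 0.
Proof.
move=> fn; rewrite (orthonormal_expansion fn) ip_sumr big1 // => j _.
by rewrite ipZr ip_p gtn_eqF ?mulr0.
Qed.

(** The Christoffel-Darboux kernel at z for degrees below n. The values are conjugated because [ip]
    is conjugate-linear on the left, so that pairing with [ker n z] is evaluation at z. *)
Let ker n z : {poly C} := \sum_(j < n) ((p j).[z])^* *: p j.

Let size_ker n z : (size (ker n z) <= n)%N.
Proof.
apply: (leq_trans (size_sum _ _ _)); apply/bigmax_leqP => j _.
by apply: (leq_trans (size_scale_leq _ _)); rewrite size_p.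
Qed.

Let ip_ker n z (f : {poly C}) : (size f <= n)%N -> ip (ker n z) f = f.[z].
Proof.
move=> fn; rewrite [in RHS](orthonormal_expansion fn) horner_sum ip_suml.
by apply: eq_bigr => j _; rewrite ipZl conjCK hornerZ mulrC.
Qed.

(** By [ip_ker] this is the sum of |p_j(z)|^2 over j < n, the reciprocal of the Christoffel
    function. *)
Let S n z := ip (ker n z) (ker n z).

Let S_gt0 n z : 0 < S n.+1 z.
Proof.
rewrite /S ip_ker ?size_ker // horner_sum big_ord_recl /=.
have [c pE] : exists c, p 0%N = c%:P.
  by exists (p 0%N)`_0; apply: size1_polyC; rewrite size_p.
have c0 : c != 0.
  by have := lead_p 0; rewrite pE lead_coefC => /gt_eqF ->.
rewrite ltr_wpDr ?sumr_ge0 //.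
  by move=> i _; rewrite hornerZ mulrC -normCK exprn_ge0.
by rewrite hornerZ mulrC -normCK exprn_gt0 // pE hornerC normr_gt0.
Qed.

(* Comparing [z * S] with the value at z of [X * ker]: the part of [X * ker] of
   degree at most n is controlled by [ip_shift], the rest is a multiple of p_n. *)
Let ker_bound n (z : C) : 1 < `|z| -> (`|z| - 1) ^+ 2 * S n.+1 z <= `|(p n.+1).[z]| ^+ 2.
Proof.
move=> z1; set s := S _ _; have s0 : 0 < s := S_gt0 n z.
pose k := ker n.+1 z; have kk : ip k k = s by [].
pose c := ip (p n.+1) ('X * k); pose f := 'X * k - c *: p n.+1.
have sX : (size ('X * k)%R <= n.+2)%N.
  rewrite mulrC; apply: (leq_trans (size_polyMleq _ _)).
  by rewrite size_polyX addn2 /= ltnS size_ker.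
have fE : f = \sum_(j < n.+1) ip (p j) ('X * k) *: p j.
  rewrite /f {1}(orthonormal_expansion sX) big_ord_recr /= addrK.
  by apply: eq_bigr.
have sf : (size f <= n.+1)%N.
  rewrite fE; apply: (leq_trans (size_sum _ _ _)); apply/bigmax_leqP => j _.
  by apply: (leq_trans (size_scale_leq _ _)); rewrite size_p.
have ipf : f.[z] = ip k ('X * k).
  rewrite -(ip_ker z sf) /f -scaleNr ipDr ipZr (ipC (p _)) ip_small ?size_ker //.
  by rewrite rmorph0 mulr0 addr0.
(* By the reproducing property k(z) = s, so the value of X k at z is z s. *)
have zs : z * s = ip k ('X * k) + c * (p n.+1).[z].
  rewrite -ipf /f hornerD hornerN hornerM hornerX hornerZ subrK.
  by rewrite -(ip_ker z (size_ker n.+1 z)).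
have fs : `|ip k ('X * k)| <= s.
  rewrite -(@ler_pXn2r _ 2) ?nnegrE ?normr_ge0 ?(ltW s0) //.
  apply: (le_trans (CauchySchwarz_ip _ _)); rewrite kk //.
  by rewrite expr2 ler_pM2l // ip_shift.
have cs : `|c| ^+ 2 <= s.
  apply: (le_trans (CauchySchwarz_ip _ _)); rewrite ip_p eqxx ?mul1r ?ltr01 //.
have zs1 : (`|z| - 1) * s <= `|c| * `|(p n.+1).[z]|.
  rewrite mulrBl mul1r lerBlDl -[X in _ * X](ger0_norm (ltW s0)) -!normrM zs.
  apply: (le_trans (ler_normD _ _)); exact: lerD.
have z0 : 0 <= `|z| - 1 by rewrite subr_ge0 ltW.
(* Square [zs1], use |c|^2 <= s, and cancel one factor s. *)
rewrite -(ler_pM2r s0) -mulrA -expr2 -exprMn.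
apply: (@le_trans _ _ ((`|c| * `|(p n.+1).[z]|) ^+ 2)).
  by rewrite ler_pXn2r ?nnegrE ?mulr_ge0 ?(ltW s0).
by rewrite exprMn mulrC ler_wpM2l // exprn_ge0.
Qed.

(** A difference of two monic polynomials of degree n+1, hence of degree at most n. Multiplied by
    l_n / p_{n+1}(z), its value at z is the quotient minus l_n / l_{n+1}. *)
Let Q n : {poly C} := 'X * ((l n)^-1 *: p n) - (l n.+1)^-1 *: p n.+1.

Let l_neq0 n : l n != 0. Proof. by rewrite gt_eqF. Qed.

Let size_Q n : (size (Q n) <= n.+1)%N.
Proof.
apply/leq_sizeP => j; rewrite /Q coefB coefXM !coefZ leq_eqVlt.
case/orP=> [/eqP <- /=|nj].
  have cl m : (p m)`_m = l m by rewrite lead_coefE size_p.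
  by rewrite !cl !mulVf ?subrr.
rewrite [in X in _ - X]nth_default ?size_p // mulr0 subr0.
by case: j nj => // j nj /=; rewrite nth_default ?mulr0 // size_p.
Qed.

(** Pythagoras: X p_n / l_n is the orthogonal sum of [Q n] and p_{n+1} / l_{n+1}, and by [ip_shift]
    its squared norm is at most l_n^-2. *)
Let ip_Q n : ip (Q n) (Q n) <= (l n) ^- 2 - (l n.+1) ^- 2.
Proof.
have lC m : ((l m)^-1)^* = (l m)^-1.
  by rewrite conj_Creal // ger0_real // invr_ge0 ltW.
have PP m : ip ((l m)^-1 *: p m) ((l m)^-1 *: p m) = (l m) ^- 2.
  by rewrite ipZl ipZr ip_p eqxx mulr1 lC -exprVn -expr2.
rewrite lerBrDr -(PP n) -PP; apply: le_trans (ip_shift _).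
have -> : 'X * ((l n)^-1 *: p n) = Q n + (l n.+1)^-1 *: p n.+1.
  by rewrite /Q subrK.
have pQ : ip (p n.+1) (Q n) = 0 by rewrite ip_small // size_Q.
have Qp : ip (Q n) (p n.+1) = 0 by rewrite ipC pQ rmorph0.
by rewrite (ipDl (Q n)) !(ipDr _ (Q n)) !ipZl !ipZr pQ Qp !mulr0 addr0 add0r.
Qed.

Lemma lead_coef_orthonormal_ndec n : l n <= l n.+1.
Proof.
have := le_trans (ip_ge0 _) (ip_Q n).
rewrite subr_ge0 lef_pV2 ?posrE ?exprn_gt0 //.
by rewrite ler_pXn2r // nnegrE ltW.
Qed.

(** Evaluating [Q n] at z costs a factor [S n.+1 z] on the squared norm, by Cauchy-Schwarz against
    the kernel; [ker_bound] absorbs this factor into |p_{n+1}(z)|^2. *)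
Lemma orthonormal_ratio_bound n (z : C) : 1 < `|z| ->
  (`|z| - 1) ^+ 2 * `|z * (p n).[z] / (p n.+1).[z] - l n / l n.+1| ^+ 2
    <= 1 - (l n / l n.+1) ^+ 2.
Proof.
move=> z1; have kb := ker_bound n z1.
have z0 : 0 < `|z| - 1 by rewrite subr_gt0.
have p0 : (p n.+1).[z] != 0.
  rewrite -normr_gt0 -(@ltr_pXn2r _ 2) ?nnegrE // expr0n /=.
  by apply: lt_le_trans kb; rewrite mulr_gt0 ?exprn_gt0.
have -> : z * (p n).[z] / (p n.+1).[z] - l n / l n.+1 =
    l n * (Q n).[z] / (p n.+1).[z].
  rewrite /Q hornerD hornerN hornerM hornerX !hornerZ; field.
  by rewrite p0 !l_neq0.
rewrite 2!normrM normfV (ger0_norm (ltW (lead_p n))) !exprMn exprVn.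
have QS : `|(Q n).[z]| ^+ 2 <= S n.+1 z * (l n ^- 2 - l n.+1 ^- 2).
  rewrite -(ip_ker z (size_Q n)); apply: (le_trans (CauchySchwarz_ip _ (S_gt0 _ _))).
  by rewrite ler_pM2l ?S_gt0.
have d0 : 0 <= l n ^- 2 - l n.+1 ^- 2 := le_trans (ip_ge0 _) (ip_Q n).
have -> : 1 - l n ^+ 2 * (l n.+1)^-1 ^+ 2 = l n ^+ 2 * (l n ^- 2 - l n.+1 ^- 2).
  by field; rewrite !l_neq0.
have a0 : 0 < (`|z| - 1) ^+ 2 by rewrite exprn_gt0.
have b0 : 0 < l n ^+ 2 by rewrite exprn_gt0.
have P0 : 0 < `|(p n.+1).[z]| ^+ 2 by rewrite exprn_gt0 ?normr_gt0.
move: kb QS d0 a0 b0 P0.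
move: (_ ^+ 2) (_ ^+ 2) (_ ^+ 2) (l n ^+ 2) => q P a b.
rewrite !mulrA => kb QS d0 a0 b0 P0.
rewrite ler_pdivrMr // -mulrA mulrCA -mulrA ler_pM2l //.
rewrite [leRHS]mulrC; apply: le_trans (ler_wpM2r d0 kb).
by rewrite -mulrA ler_pM2l.
Qed.
End orthonormal_sequence.

(** * Modulus, topology of the plane and of the sphere *)

Section complex_topology.
Local Set Implicit Arguments.
Local Unset Strict Implicit.
Variable R : realType.
Local Notation C := R[i].

(** The norm of [R[i]] takes its values in [R[i]]; this is the modulus as an element of [R], where
    suprema, integrals and limits are taken. *)
Definition cnorm (z : C) : R := complex.Re `|z|.

Lemma cnormE (z : C) : `|z| = (cnorm z)%:C.
Proof. by rewrite /cnorm normc_def. Qed.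

Lemma cnorm_sqrt (z : C) :
  cnorm z = Num.sqrt (complex.Re z ^+ 2 + complex.Im z ^+ 2).
Proof. by rewrite /cnorm normc_def. Qed.

Lemma cnorm_ge0 z : 0 <= cnorm z.
Proof. by rewrite cnorm_sqrt sqrtr_ge0. Qed.

Lemma cnormM x y : cnorm (x * y) = cnorm x * cnorm y.
Proof. by apply: complexI; rewrite rmorphM /= -!cnormE normrM. Qed.

Lemma cnormD x y : cnorm (x + y) <= cnorm x + cnorm y.
Proof. by rewrite -lecR rmorphD /= -!cnormE ler_normD. Qed.

Lemma cnorm_distl x y : cnorm x - cnorm y <= cnorm (x - y).
Proof. by rewrite lerBlDr -{1}(subrK y x) cnormD. Qed.

Lemma cnormB x y : cnorm (x - y) = cnorm (y - x).
Proof. by rewrite /cnorm distrC. Qed.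

Lemma cnorm_real (x : R) : cnorm x%:C = `|x|.
Proof. by rewrite cnorm_sqrt /= expr0n /= addr0 sqrtr_sqr. Qed.

Lemma normr_Re_le_cnorm z : `|complex.Re z| <= cnorm z.
Proof. by rewrite cnorm_sqrt -sqrtr_sqr ler_wsqrtr // lerDl sqr_ge0. Qed.

Lemma normr_Im_le_cnorm z : `|complex.Im z| <= cnorm z.
Proof. by rewrite cnorm_sqrt -sqrtr_sqr ler_wsqrtr // lerDr sqr_ge0. Qed.

Lemma cnorm_le_ReIm z : cnorm z <= `|complex.Re z| + `|complex.Im z|.
Proof.
rewrite cnorm_sqrt -(@ler_pXn2r _ 2) ?nnegrE ?sqrtr_ge0 ?addr_ge0 //.
rewrite sqr_sqrtr ?addr_ge0 ?sqr_ge0 // sqrrD !real_normK ?num_real //.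
by rewrite addrAC lerDl mulrn_wge0 // mulr_ge0.
Qed.

Lemma nbhs_cnorm (z : C) (e : R) : 0 < e -> \forall w \near z, cnorm (z - w) < e.
Proof.
move=> e0; have e0C : 0 < e%:C by rewrite (ltcR 0).
apply: filterS (nbhsx_ballx z _ e0C) => w.
by rewrite -ball_normE /ball_ /= cnormE ltcR.
Qed.

Lemma lipschitz_cnorm_continuous (f : C -> R) :
  (forall x y, `|f x - f y| <= cnorm (x - y)) -> continuous f.
Proof.
move=> fL z; apply/(@cvgrPdist_lt _ _ _ (nbhs z) _) => e e0.
by apply: filterS (nbhs_cnorm z e0) => w; apply: le_lt_trans.
Qed.

Lemma continuous_Re : continuous (@complex.Re R).
Proof.
apply: lipschitz_cnorm_continuous => x y.
by apply: le_trans (normr_Re_le_cnorm (x - y)); case: x y => [a b] [c d].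
Qed.

Lemma continuous_Im : continuous (@complex.Im R).
Proof.
apply: lipschitz_cnorm_continuous => x y.
by apply: le_trans (normr_Im_le_cnorm (x - y)); case: x y => [a b] [c d].
Qed.

Lemma continuous_cnorm : continuous cnorm.
Proof.
apply: lipschitz_cnorm_continuous => x y.
by rewrite ler_norml cnorm_distl andbT lerNl opprB cnormB cnorm_distl.
Qed.

Lemma cvg_complex T (F : set_system T) (FF : Filter F) (f : T -> C) (l : C) :
  (fun t => complex.Re (f t)) @ F --> complex.Re l ->
  (fun t => complex.Im (f t)) @ F --> complex.Im l -> f @ F --> l.
Proof.
move=> /cvgrPdist_lt hRe /cvgrPdist_lt hIm; apply/cvgrPdist_lt => e e0.
have [e' e'0 eE] : exists2 e', 0 < e' & e = e'%:C.
  move: e e0 => [a b]; rewrite ltcE /= => /andP[/eqP b0 a0].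
  by exists a; rewrite // b0.
have e2 : 0 < e' / 2 by rewrite divr_gt0.
near=> t; rewrite cnormE eE ltcR; apply: (le_lt_trans (cnorm_le_ReIm _)).
rewrite (splitr e'); apply: ltrD.
  rewrite (_ : complex.Re _ = complex.Re l - complex.Re (f t)).
    by near: t; exact: hRe.
  by case: (l) (f t) => [a b] [c d].
rewrite (_ : complex.Im _ = complex.Im l - complex.Im (f t)).
  by near: t; exact: hIm.
by case: (l) (f t) => [a b] [c d].
Unshelve. all: by end_near. Qed.

Lemma closed_cnorm_le r : closed [set z : C | cnorm z <= r].
Proof.
apply: (@preimage_closed _ _ cnorm [set x | x <= r]); last exact: closed_le.
by move=> x _; exact: continuous_cnorm.
Qed.

Lemma compact_cnorm_le r : compact [set z : C | cnorm z <= r].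
Proof.
pose f (xy : R * R) : C := xy.1 +i* xy.2.
have fc : continuous f.
  move=> xy; apply: cvg_complex => /=; [exact: cvg_fst|exact: cvg_snd].
have cs : compact (`[- r, r]%classic `*` `[- r, r]%classic : set (R * R)).
  by apply: compact_setX; exact: segment_compact.
apply: subclosed_compact (continuous_compact (continuous_subspaceT fc) cs) _.
  exact: closed_cnorm_le.
move=> z /= zr; exists (complex.Re z, complex.Im z); last by case: (z).
split; rewrite /= in_itv /= -ler_norml; apply: le_trans zr.
  exact: normr_Re_le_cnorm.
exact: normr_Im_le_cnorm.
Qed.

Lemma closed_diskE : closed_disk R = [set z | cnorm z <= 1].
Proof. by apply/funext => z; rewrite /closed_disk /= cnormE (lecR _ 1). Qed.

(** Compactness in near-covering form makes a locally valid margin d uniform. Near a finite z any d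
    below (|z| - 1)/2 works; near infinity, where |z| > 2, any d < 1 does. *)
Lemma compact_sphere_dist (K : set (sphere R)) :
  compact K -> K `<=` ~` (Some @` closed_disk R) ->
  exists2 d : R, 0 < d & forall z, K (Some z) -> 1 + d <= cnorm z.
Proof.
move=> /compact_near_coveringP cK K1.
have h : \forall d \near (0 : R)^'+,
    K `<=` (fun x => if x is Some z then 1 + d <= cnorm z else True).
  apply: cK.
  move=> [z|] Kz.
    have z1 : 1 < cnorm z.
      rewrite ltNge; apply/negP => z1; apply: (K1 _ Kz).
      by exists z => //; rewrite closed_diskE.
    have e0 : 0 < (cnorm z - 1) / 2 by rewrite divr_gt0 // subr_gt0.
    exists (Some @` [set w | cnorm (z - w) < (cnorm z - 1) / 2],
            [set d | d < (cnorm z - 1) / 2]).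
      split => /=.
        exact/one_point_compactification_some_nbhs/nbhs_cnorm.
      exact: nbhs_right_lt.
    move=> [_ d] /= [[w wz <-]] dz.
    have := cnorm_distl z w; lra.
  exists ((Some @` (~` [set z | cnorm z <= 2])) `|` [set None], [set d : R | d < 1]).
    split => /=; last by apply: nbhs_right_lt.
    exists [set z | cnorm z <= 2] => //; split.
      exact: compact_cnorm_le.
    exact: closed_cnorm_le.
  move=> [x d] /= [[[w /negP]|->//]].
  by rewrite -ltNge => w2 <- d1; lra.
have [e [e0 he]] := filter_ex (filterI (nbhs_right_gt (0 : R)) h).
by exists e => // z Kz; exact: (he (Some z)).
Qed.
End complex_topology.

(** * Integration against a measure supported in the disk *)

Section measure_on_disk.
Local Set Implicit Arguments.
Local Unset Strict Implicit.
Variable R : realType.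
Local Notation C := R[i].

Lemma continuous_horner (f : {poly C}) : continuous (horner f).
Proof.
elim/poly_ind: f => [|f c IH].
  have -> : horner (0 : {poly C}) = cst 0 by apply/funext => w; rewrite horner0.
  exact: cst_continuous.
have -> : horner (f * 'X + c%:P) = (fun w => f.[w] * w + c).
  by apply/funext => w; rewrite hornerMXaddC.
move=> z; apply: (@cvgD _ _ _ (nbhs z) _ (fun w => f.[w] * w) (fun=> c)).
  apply: (@cvgM _ _ (nbhs z) _ (horner f) id); [exact: IH|exact: cvg_id].
exact: cvg_cst.
Qed.

Lemma continuous_conjc : continuous (fun z : C => z^*).
Proof.
move=> z; apply: (@cvg_complex _ _ (nbhs z)).
  have -> : (fun w : C => complex.Re w^*) = @complex.Re R by apply/funext => -[].
  by have := @continuous_Re R z; case: (z).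
have -> : (fun w : C => complex.Im w^*) = (fun w => - complex.Im w).
  by apply/funext => -[].
have -> : complex.Im z^* = - complex.Im z by case: (z).
apply: (@cvgN _ _ _ (nbhs z)); exact: continuous_Im.
Qed.

Lemma open_measurable_borelC (U : set C) : open U -> measurable (U : set (borelC R)).
Proof. by move=> oU; apply: sub_sigma_algebra. Qed.

Lemma closed_measurable_borelC (U : set C) :
  closed U -> measurable (U : set (borelC R)).
Proof.
move=> cU; rewrite -[U]setCK; apply: measurableC.
by apply: open_measurable_borelC; exact: closed_openC.
Qed.

Lemma continuous_measurable_borelC (f : C -> R) :
  continuous f -> measurable_fun [set: borelC R] (f : borelC R -> R).
Proof.
move=> cf; apply: (measurability _ (RGenOInfty.measurableE R)).
move=> _ [_ [x ->] <-]; rewrite setTI; apply: open_measurable_borelC.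
move/continuousP: cf; apply; exact: interval_open.
Qed.

Section integral.
Variable mu : {finite_measure set (borelC R) -> \bar R}.
Hypothesis supp_mu : supp mu `<=` closed_disk R.

Let off_disk : set (borelC R) := [set z : C | 1 < cnorm z].

Let measurable_off_disk : measurable off_disk.
Proof.
rewrite (_ : off_disk = (~` [set z : C | cnorm z <= 1] : set C)).
  apply: open_measurable_borelC; apply: closed_openC; exact: closed_cnorm_le.
by apply/seteqP; split => z; rewrite /off_disk /= ltNge => /negP.
Qed.

(** A point outside the support has an open null neighbourhood, but uncountably many of these would
    be used. The exterior is therefore exhausted by the compact annuli [A n], each covered by
    finitely many of them. *)
Lemma off_disk_null : mu off_disk = 0%E.
Proof.
have null_nbhs (z : C) : 1 < cnorm z -> exists U : set C, [/\ open U, U z & mu U = 0%E].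
  move=> z1; apply: contrapT => nU.
  suff /supp_mu : supp mu z by rewrite closed_diskE /= leNgt z1.
  move=> U oU Uz; rewrite lt0e measure_ge0 andbT; apply/eqP => mU.
  by apply: nU; exists U.
pose A n : set C := [set z | 1 + n.+1%:R^-1 <= cnorm z] `&` [set z | cnorm z <= n%:R].
have clA n : closed [set z : C | 1 + n.+1%:R^-1 <= cnorm z].
  apply: (@preimage_closed _ _ (@cnorm R) [set x | 1 + n.+1%:R^-1 <= x]).
    by move=> x _; exact: continuous_cnorm.
  exact: closed_ge.
have cA n : compact (A n).
  apply: subclosed_compact (@compact_cnorm_le R n%:R) (@subIsetr _ _ _).
  by apply: closedI => //; exact: closed_cnorm_le.
have mA n : measurable (A n : set (borelC R)).
  apply: closed_measurable_borelC; apply: closedI => //; exact: closed_cnorm_le.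
have A0 n : mu (A n) = 0%E.
  have := cA n; rewrite compact_cover.
  move=> /(_ (set C) [set U : set C | open U /\ mu U = 0%E] id).
  case; first by move=> U [].
    move=> z [/= z1 _].
    have [|U [oU Uz U0]] := null_nbhs z; last by exists U.
    by apply: lt_le_trans z1; rewrite ltrDl invr_gt0.
  move=> D DD; set S := (X in cover X) => AD; apply/eqP; rewrite eq_le measure_ge0 andbT.
  have DS (U : set C) : S U -> open U /\ mu U = 0%E.
    by move=> UD; have := DD U UD; rewrite inE.
  have := @content_sub_fsum _ _ _ mu _ S (A n) id.
  move=> /(_ (finite_fset _)) h; apply: (le_trans (h _ _ _)) => //.
    by move=> U /DS[/open_measurable_borelC].
  by apply: fsume_le0 => U /DS[_ U0] /=; rewrite U0.
have : mu.-negligible off_disk.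
  apply: (@negligibleS _ _ _ mu (\bigcup_n A n)); last first.
    by apply: negligible_bigcup => n; apply/negligibleP; [exact: mA|exact: A0].
  move=> z /= z1.
  have z0 : 0 < cnorm z - 1 by rewrite subr_gt0.
  have [n [/= n1 n2]] := filter_ex (filterI
    (near_infty_natSinv_lt (PosNum z0)) (nbhs_infty_ger (cnorm z))).
  by exists n => //; split => //=; rewrite -lerBrDl ltW.
by move=> /negligibleP; apply.
Qed.

(** [f] is bounded on the compact disk, which has finite measure, and the rest is null. *)
Lemma continuous_integrable (f : C -> R) : continuous f ->
  mu.-integrable [set: borelC R] (EFin \o f).
Proof.
move=> cf; have mf := continuous_measurable_borelC cf.
apply/(negligible_integrable measurable_off_disk) => //.
  exact/measurable_EFinP.
  exact: off_disk_null.
rewrite setTD; apply: measurable_bounded_integrable.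
- exact: measurableC.
- by rewrite ltey_eq fin_num_measure //; exact: measurableC.
- exact: measurable_funS mf.
have -> : ~` off_disk = [set z | cnorm z <= 1].
  by apply/seteqP; split => z; rewrite /off_disk /= leNgt => /negP.
have := compact_bounded (continuous_compact (continuous_subspaceT cf) (@compact_cnorm_le R 1)).
move=> [M [Mr hM]]; exists M; split => // N MN z /= z1.
by apply: (hM N MN); exists z.
Qed.
Let cintegrable (F : C -> C) : continuous F ->
  mu.-integrable [set: borelC R] (EFin \o (@complex.Re R \o F)) /\
  mu.-integrable [set: borelC R] (EFin \o (@complex.Im R \o F)).
Proof.
by move=> cF; split; apply: continuous_integrable => z; apply: continuous_comp;
  [exact: cF|exact: continuous_Re|exact: cF|exact: continuous_Im].
Qed.

Lemma cintegralD (F G : C -> C) : continuous F -> continuous G ->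
  cintegral mu (fun z => F z + G z) = cintegral mu F + cintegral mu G.
Proof.
move=> /cintegrable[F1 F2] /cintegrable[G1 G2].
have ReD (a b : C) : complex.Re (a + b) = complex.Re a + complex.Re b.
  by case: a b => [? ?] [? ?].
have ImD (a b : C) : complex.Im (a + b) = complex.Im a + complex.Im b.
  by case: a b => [? ?] [? ?].
rewrite /cintegral.
under eq_Rintegral do rewrite ReD.
under [X in _ +i* X]eq_Rintegral do rewrite ImD.
by rewrite !RintegralD.
Qed.

Lemma cintegralZ (c : C) (F : C -> C) : continuous F ->
  cintegral mu (fun z => c * F z) = c * cintegral mu F.
Proof.
move=> /cintegrable[F1 F2]; case: c => a b.
have ReM (w : C) : complex.Re ((a +i* b) * w) = a * complex.Re w - b * complex.Im w.
  by case: w.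
have ImM (w : C) : complex.Im ((a +i* b) * w) = a * complex.Im w + b * complex.Re w.
  by case: w.
rewrite /cintegral.
under eq_Rintegral do rewrite ReM.
under [X in _ +i* X]eq_Rintegral do rewrite ImM.
have iZ (k : R) (f : borelC R -> R) : mu.-integrable setT (EFin \o f) ->
    mu.-integrable setT (EFin \o (fun x => k * f x)).
  by move=> fi; apply: eq_integrable (integrableZl _ k fi).
have [ia ib] := (iZ a _ F1, iZ b _ F2).
have [ja jb] := (iZ a _ F2, iZ b _ F1).
by rewrite RintegralB ?RintegralD // !RintegralZl.
Qed.

Lemma cintegral_conj (F : C -> C) : continuous F ->
  cintegral mu (fun z => (F z)^*) = (cintegral mu F)^*.
Proof.
move=> /cintegrable[F1 F2]; rewrite /cintegral /=.
congr (_ +i* _); first by apply: eq_Rintegral => z _; case: (F z).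
rewrite -mulN1r -RintegralZl //; apply: eq_Rintegral => z _.
by rewrite mulN1r; case: (F z).
Qed.

Let continuous_sesqui (f g : {poly C}) :
  continuous (fun z : C => f.[z]^* * g.[z]).
Proof.
move=> z; apply: (@cvgM _ _ (nbhs z) _ (fun w => f.[w]^*) (horner g)).
  apply: (@continuous_comp _ _ _ (horner f)); first exact: continuous_horner.
  exact: continuous_conjc.
exact: continuous_horner.
Qed.

(** From here to [ip_mulX_le], the form f, g |-> integral of conj(f) g is shown to satisfy the
    hypotheses on [ip] of the abstract section. *)
Lemma ip_addr (f g h : {poly C}) :
  cintegral mu (fun z => f.[z]^* * (g + h).[z]) =
  cintegral mu (fun z => f.[z]^* * g.[z]) + cintegral mu (fun z => f.[z]^* * h.[z]).
Proof.
rewrite -cintegralD; [|exact: continuous_sesqui..].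
by congr cintegral; apply/funext => z; rewrite hornerD mulrDr.
Qed.

Lemma ip_scaler (f : {poly C}) (c : C) (g : {poly C}) :
  cintegral mu (fun z => f.[z]^* * (c *: g).[z]) =
  c * cintegral mu (fun z => f.[z]^* * g.[z]).
Proof.
rewrite -cintegralZ; last exact: continuous_sesqui.
by congr cintegral; apply/funext => z; rewrite hornerZ mulrCA.
Qed.

Lemma ip_conj (f g : {poly C}) :
  cintegral mu (fun z => g.[z]^* * f.[z]) =
  (cintegral mu (fun z => f.[z]^* * g.[z]))^*.
Proof.
rewrite -cintegral_conj; last exact: continuous_sesqui.
by congr cintegral; apply/funext => z; rewrite rmorphM /= conjcK mulrC.
Qed.

Let ip_diag (f : {poly C}) :
  cintegral mu (fun z => f.[z]^* * f.[z]) = (\int[mu]_z (cnorm f.[z] ^+ 2))%:C.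
Proof.
have E (w : C) : w^* * w = (cnorm w ^+ 2)%:C.
  by rewrite mulrC -sqr_normc cnormE rmorphXn.
rewrite /cintegral; congr (_ +i* _); first by under eq_Rintegral do rewrite E.
under eq_Rintegral do rewrite E /=.
by rewrite /Rintegral integral0.
Qed.

Lemma ip_diag_ge0 (f : {poly C}) : 0 <= cintegral mu (fun z => f.[z]^* * f.[z]).
Proof. by rewrite ip_diag ler0c; apply: Rintegral_ge0 => z _; rewrite sqr_ge0. Qed.

Let continuous_sqr_cnorm (f : {poly C}) : continuous (fun z : C => cnorm f.[z] ^+ 2).
Proof.
have cf : continuous (fun z : C => cnorm f.[z]).
  move=> z; apply: (@continuous_comp _ _ _ (horner f)); first exact: continuous_horner.
  exact: continuous_cnorm.
by move=> z; apply: (@cvgM _ _ (nbhs z)); exact: cf.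
Qed.

Lemma ip_mulX_le (f : {poly C}) :
  cintegral mu (fun z => ('X * f).[z]^* * ('X * f).[z]) <=
  cintegral mu (fun z => f.[z]^* * f.[z]).
Proof.
(* The pointwise bound |z f(z)| <= |f(z)| holds on the disk only, so both integrals are first
   restricted to it. *)
have on_disk (h : C -> R) : continuous h ->
    \int[mu]_z h z = \int[mu]_(z in ~` off_disk) h z.
  move=> ch; rewrite /Rintegral -(setTD off_disk); congr fine.
  apply: negligible_integral => //; first exact: continuous_integrable.
  exact: off_disk_null.
have mD : measurable (~` off_disk) by exact: measurableC.
have iD (h : C -> R) : continuous h -> mu.-integrable (~` off_disk) (EFin \o h).
  move=> ch; apply: (@integrableS _ _ _ mu setT) => //.
  exact: continuous_integrable.
have c1 := @continuous_sqr_cnorm ('X * f); have c2 := @continuous_sqr_cnorm f.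
rewrite !ip_diag lecR (on_disk _ c1) (on_disk _ c2).
apply: (le_Rintegral mD (iD _ c1) (iD _ c2)) => z.
rewrite /off_disk /= => /negP; rewrite -leNgt => z1.
rewrite hornerM hornerX cnormM exprMn ler_piMl ?sqr_ge0 //.
by rewrite exprn_ile1 // cnorm_ge0.
Qed.
End integral.
End measure_on_disk.

(** * Equally spaced points on the unit circle *)

Section circle.
Local Set Implicit Arguments.
Local Unset Strict Implicit.
Variable R : realType.
Local Notation C := R[i].

(** Period 1, so that Lebesgue measure on [0, 1[ is carried to normalized arc length. *)
Definition circle_point (t : R) : C := cos (2 * pi * t) +i* sin (2 * pi * t).

Lemma cnorm_circle_point t : cnorm (circle_point t) = 1.
Proof. by rewrite cnorm_sqrt /= cos2Dsin2 sqrtr1. Qed.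

Lemma circle_point_half t : circle_point (t + 2^-1) = - circle_point t.
Proof.
rewrite /circle_point (_ : 2 * pi * (t + 2^-1) = 2 * pi * t + pi); last by field.
by rewrite cosDpi sinDpi.
Qed.

Lemma circle_point_double t : circle_point (2 * t) = circle_point t ^+ 2.
Proof.
rewrite /circle_point (_ : 2 * pi * (2 * t) = (2 * pi * t) *+ 2).
  rewrite cos_mulr2n sin_mulr2n expr2; congr (_ +i* _); last by ring.
  by rewrite -[X in _ - X = _](cos2Dsin2 (2 * pi * t)); ring.
by rewrite mulr2n; ring.
Qed.

Lemma continuous_circle_point : continuous circle_point.
Proof.
have cM : continuous (fun t : R => 2 * pi * t) by exact: mulrl_continuous.
move=> t; apply: (@cvg_complex _ _ (nbhs t)).
  by apply: (@continuous_comp _ _ _ _ cos); [exact: cM|exact: continuous_cos].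
by apply: (@continuous_comp _ _ _ _ sin); [exact: cM|exact: continuous_sin].
Qed.

(** The points are the 2^n-th roots of e(th). In the induction, the indices k and 2^n + k give
    antipodal points w and -w; (z - w)(z + w) = z^2 - w^2, and the squares w^2 form the previous
    grid. *)
Lemma prod_circle_point n (z : C) (th : R) :
  \prod_(k < 2 ^ n) (z - circle_point ((k%:R + th) / (2 ^ n)%:R)) =
  z ^+ (2 ^ n) - circle_point th.
Proof.
elim: n z => [|n IH] z.
  by rewrite big_ord1 add0r divr1 expr1.
rewrite expnS mul2n -addnn big_split_ord /= -big_split /=.
rewrite addnn -mul2n exprM -IH; apply: eq_bigr => k _.
have N0 : (2 ^ n)%:R != 0 :> R by rewrite pnatr_eq0 expn_eq0.
pose u : R := (k%:R + th) / (2 * 2 ^ n)%:R; rewrite -/u.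
have -> : ((2 ^ n + k)%:R + th) / (2 * 2 ^ n)%:R = u + 2^-1.
  by rewrite /u natrD natrM; field.
have -> : (k%:R + th) / (2 ^ n)%:R = 2 * u by rewrite /u natrM; field.
by rewrite circle_point_half circle_point_double; ring.
Qed.
End circle.

(** * The logarithmic potential of the circle *)

Section circle_potential.
Local Set Implicit Arguments.
Local Unset Strict Implicit.
Variable R : realType.
Local Notation C := R[i].
Local Notation leb := (@lebesgue_measure R).

(** Presents a Riemann sum as an integral over [0, 1[, the form in which Fatou's lemma applies. *)
Definition step_function (n : nat) (g : nat -> R) (t : R) : R :=
  \sum_(k < n) g k * \1_(`[k%:R / n%:R, k.+1%:R / n%:R[%classic : set R) t.

Lemma step_functionE n g t : 0 <= t < 1 -> (0 < n)%N ->
  step_function n g t = g (Num.truncn (t * n%:R)).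
Proof.
move=> /andP[t0 t1] n0; have nR : 0 < n%:R :> R by rewrite ltr0n.
have tn : 0 <= t * n%:R by rewrite mulr_ge0 // ltW.
have kn : (Num.truncn (t * n%:R) < n)%N.
  by rewrite truncn_lt_nat // gtr_pMl.
have E (k : nat) : \1_(`[k%:R / n%:R, k.+1%:R / n%:R[%classic : set R) t =
    (k == Num.truncn (t * n%:R))%:R.
  rewrite indicE; congr (_%:R); rewrite mem_setE in_itv /= eq_sym truncn_eq //.
  by rewrite ler_pdivrMr // ltr_pdivlMr.
rewrite /step_function (bigD1 (Ordinal kn)) //= E eqxx mulr1 big1 ?addr0 //.
move=> k kk; rewrite E (_ : (_ == _) = false) ?mulr0 //.
by apply/negbTE; apply: contraNneq kk => kk; apply/eqP/val_inj.
Qed.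

Let measurable_term n (g : nat -> R) (k : nat) (D : set R) : measurable_fun D
  (fun t => (g k * \1_(`[k%:R / n%:R, k.+1%:R / n%:R[%classic : set R) t)%:E).
Proof.
apply/measurable_EFinP; apply: measurable_funM; first exact: measurable_cst.
exact: measurable_indic.
Qed.

Lemma measurable_step_function n g (D : set R) :
  measurable_fun D (fun t => (step_function n g t)%:E).
Proof.
rewrite /step_function; under eq_fun do rewrite -sumEFin.
by apply: emeasurable_sum => k; exact: measurable_term.
Qed.

Lemma integral_step_function n (g : nat -> R) : (0 < n)%N -> (forall k, 0 <= g k) ->
  (\int[leb]_(t in `[0%R, 1%R[) (step_function n g t)%:E =
   ((\sum_(k < n) g k) / n%:R)%:E)%E.
Proof.
move=> n0 g0; rewrite /step_function; under eq_integral do rewrite -sumEFin.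
have nR : 0 < n%:R :> R by rewrite ltr0n.
rewrite ge0_integral_sum //; last 2 first.
- by move=> k; exact: measurable_term.
- by move=> k t _; rewrite lee_fin mulr_ge0.
rewrite mulr_suml -sumEFin; apply: eq_bigr => k _.
under eq_integral do rewrite EFinM.
rewrite ge0_integralZl_EFin //; last first.
  by apply/measurable_EFinP; exact: measurable_indic.
rewrite integral_indic // EFinM; congr (_ * _)%E.
rewrite setIidl; last first.
  move=> t /=; rewrite !in_itv /= => /andP[t0 t1].
  rewrite (le_trans _ t0) ?divr_ge0 //= (lt_le_trans t1) //.
  by rewrite ler_pdivrMr // mul1r ler_nat.
apply: etrans (lebesgue_measure_itv _) _.
rewrite /= lte_fin ltr_pM2r ?invr_gt0 // ltr_nat ltnSn.
by rewrite -EFinB -mulrBl -natr1 addrC addKr mul1r.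
Qed.

Definition log_kernel (x : R) : \bar R := (- lne x%:E)%E.

Lemma log_kernelE x : 0 < x -> log_kernel x = (- ln x)%:E.
Proof. by move=> x0; rewrite /log_kernel lne_EFin. Qed.

Lemma log_kernel0 : log_kernel 0 = +oo%E.
Proof. by rewrite /log_kernel le0_lneNy. Qed.

Lemma measurable_log_kernel : measurable_fun setT log_kernel.
Proof.
rewrite (_ : log_kernel = fun x => if x <= 0 then +oo%E else (- ln x)%:E).
  apply: measurable_fun_ifT => //.
    exact: measurable_fun_ler.
  by apply/measurable_EFinP; apply: measurableT_comp => //; exact: measurable_ln.
apply/funext => x; case: ifPn => [x0|]; first by rewrite /log_kernel le0_lneNy.
by rewrite -ltNge; exact: log_kernelE.
Qed.

Lemma cvg_log_kernel (u : nat -> R) (l : R) : (forall n, 0 < u n) -> 0 <= l ->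
  u @ \oo --> l -> (fun n => log_kernel (u n)) @ \oo --> log_kernel l.
Proof.
move=> u0; rewrite le_eqVlt => /orP[/eqP <-|l0] ul; last first.
  rewrite log_kernelE //; under eq_fun do rewrite log_kernelE //.
  apply: cvg_EFin; first exact: nearW.
  by apply: cvgN; apply: cvg_comp ul _; exact: continuous_ln.
rewrite log_kernel0; apply/cvgeyPge => A.
move/cvgrPdist_lt: ul => /(_ (expR (- A)) (expR_gt0 _)).
apply: filterS => n; rewrite sub0r normrN gtr0_norm // => un.
rewrite log_kernelE // lee_fin lerNr -(expRK (- A)) ler_ln ?posrE ?expR_gt0 //.
exact: ltW.
Qed.

(** |z - w| <= 1 + |z|. Adding ln (1 + |z|) thus makes the kernel nonnegative on the circle, as
    Fatou's lemma demands. *)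
Lemma log_kernel_ge (z w : C) : cnorm w = 1 ->
  ((- ln (1 + cnorm z))%:E <= log_kernel (cnorm (z - w)%R))%E.
Proof.
move=> w1; have := cnorm_ge0 (z - w); rewrite le_eqVlt => /orP[/eqP <-|zw].
  by rewrite log_kernel0 leey.
rewrite log_kernelE // lee_fin lerN2 ler_ln ?posrE //; last first.
  by rewrite ltr_pwDl // cnorm_ge0.
have := cnormD z (- w); rewrite addrC.
by rewrite -[- w]sub0r cnormB subr0 w1 (addrC (cnorm z)).
Qed.

(** 1 and -1 are at distance 2, so one of them is at distance at least 1 from w. *)
Lemma circle_point_phase (w : C) :
  exists2 th : R, 0 <= th <= 1 & 1 <= cnorm (w - circle_point th).
Proof.
have e0 : circle_point 0 = 1 :> C.
  by rewrite /circle_point mulr0 cos0 sin0.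
have e1 : circle_point 2^-1 = -1 :> C.
  by rewrite -[2^-1]add0r circle_point_half e0.
have : 2 <= cnorm (w + 1) + cnorm (w - 1).
  have -> : 2 = cnorm ((w + 1) - (w - 1)).
    rewrite (_ : _ - _ = (2 : R)%:C); first by rewrite cnorm_real ger0_norm.
    by rewrite rmorphD /= rmorph1; ring.
  by rewrite (cnormB w 1) (le_trans (cnormD _ _)) // opprB.
case: (leP 1 (cnorm (w - 1))) => [w1 _|w1 w2].
  by exists 0; rewrite ?e0 // lexx ler01.
exists 2^-1; first by apply/andP; split; lra.
by rewrite e1 opprK; lra.
Qed.

(* Fatou's lemma for Riemann sums at the 2^n points (k + th_n) / 2^n: by
   [prod_circle_point] such a sum is - ln |z^(2^n) - e(th_n)| / 2^n, and th_n is
   chosen so as to make it nonpositive. *)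
Lemma circle_potential_shifted_le (z : C) (c := ln (1 + cnorm z)) :
  (\int[leb]_(t in `[0%R, 1%R[) (c%:E + log_kernel (cnorm (z - circle_point t)%R))
    <= c%:E)%E.
Proof.
have /choice[th thP] n : exists th : R,
    0 <= th <= 1 /\ 1 <= cnorm (z ^+ (2 ^ n) - circle_point th).
  by have [th] := circle_point_phase (z ^+ (2 ^ n)); exists th.
have N0 n : (0 < 2 ^ n)%N by rewrite expn_gt0.
pose N n : R := (2 ^ n)%:R.
have NR n : 0 < N n by rewrite ltr0n.
pose s n k : R := (k%:R + th n) / N n.
pose u n k : R := cnorm (z - circle_point (s n k)).
have prod_u n : \prod_(k < 2 ^ n) u n k = cnorm (z ^+ (2 ^ n) - circle_point (th n)).
  rewrite -prod_circle_point (big_morph (@cnorm R) (@cnormM R) (id1 := 1)) //.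
  by rewrite -(normr1 R) -cnorm_real.
(* No grid point equals z: a zero factor would contradict a product of modulus at least 1. *)
have u_gt0 n (k : 'I_(2 ^ n)) : 0 < u n k.
  rewrite lt_neqAle cnorm_ge0 andbT eq_sym; apply/eqP => u0.
  have := (thP n).2; rewrite -prod_u (bigD1 k) //= u0 mul0r; lra.
have c_ge0 : 0 <= c by rewrite ln_ge0 // lerDl cnorm_ge0.
pose g n k : R := c - ln (u n k).
have g_ge0 n k : 0 <= g n k.
  (* [u_gt0] covers k < 2^n only; where [u n k <= 0], [ln] is 0 and the claim becomes 0 <= c. *)
  rewrite subr_ge0; case: (leP (u n k) 0) => [/ln0 -> //|uk].
  have := @log_kernel_ge z _ (cnorm_circle_point (s n k)).
  by rewrite log_kernelE // lee_fin lerN2.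
pose f n t : \bar R := (step_function (2 ^ n) (g n) t)%:E.
(* The sum of the g_k is 2^n c minus the logarithm of the product of distances, and that product is
   at least 1. *)
have f_int n : (\int[leb]_(t in `[0%R, 1%R[) f n t <= c%:E)%E.
  rewrite integral_step_function // lee_fin ler_pdivrMr ?NR //.
  rewrite sumrB sumr_const card_ord mulr_natr lerBlDr lerDl.
  rewrite -[X in 0 <= X]expRK expR_sum.
  under eq_bigr do rewrite lnK ?posrE //.
  by rewrite prod_u ln_ge0 // (thP n).2.
have f_cvg t : 0 <= t < 1 ->
    f ^~ t @ \oo --> (c%:E + log_kernel (cnorm (z - circle_point t)%R))%E.
  move=> t01; have [t0 t1] := andP t01.
  pose k n := Num.truncn (t * N n).
  have tN n : 0 <= t * N n by rewrite mulr_ge0 // ltW // NR.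
  have kN n : (k n < 2 ^ n)%N by rewrite /k truncn_lt_nat // gtr_pMl ?NR.
  have fE : f ^~ t = (fun n => c%:E + log_kernel (u n (k n)))%E.
    apply/funext => n; rewrite /f step_functionE // -/(k n) /g.
    by rewrite (log_kernelE (u_gt0 n (Ordinal (kN n)))).
  rewrite fE; apply: cvgeD; [exact: fin_num_adde_defr|exact: cvg_cst|].
  apply: cvg_log_kernel; last first.
  (* k <= 2^n t < k + 1 and 0 <= th_n <= 1 put the sample point within 2^-n of t, whatever the
     rotation. *)
  - have sk : (fun n => s n (k n)) @ \oo --> t.
      have sk n : t - n.+1%:R^-1 <= s n (k n) <= t + n.+1%:R^-1.
        have [kt tk] := andP (truncn_itv (tN n)).
        have [/andP[th0 th1] _] := thP n.
        have Nn : (N n)^-1 <= n.+1%:R^-1.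
          by rewrite lef_pV2 ?posrE ?NR ?ltr0n // ler_nat ltn_expl.
        apply/andP; split.
          apply: (@le_trans _ _ (t - (N n)^-1)); first by rewrite lerB.
          rewrite /s ler_pdivlMr ?NR // mulrBl mulVf ?gt_eqF ?NR //.
          by rewrite lerBlDr (le_trans (ltW tk)) // -natr1 lerD // lerDl.
        apply: (@le_trans _ _ (t + (N n)^-1)); last by rewrite lerD.
        rewrite /s ler_pdivrMr ?NR // mulrDl mulVf ?gt_eqF ?NR //.
        by rewrite lerD.
      have nsk : \forall n \near \oo, t - n.+1%:R^-1 <= s n (k n) <= t + n.+1%:R^-1.
        exact: nearW.
      apply: (squeeze_cvgr nsk).
        by rewrite -[X in _ --> X]subr0; apply: cvgB; [exact: cvg_cst|exact: cvg_harmonic].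
      by rewrite -[X in _ --> X]addr0; apply: cvgD; [exact: cvg_cst|exact: cvg_harmonic].
    have cz : continuous (fun t => cnorm (z - circle_point t)).
      move=> x; apply: (@continuous_comp _ _ _ (fun t => z - circle_point t)); last first.
        exact: continuous_cnorm.
      apply: (@cvgB _ C _ (nbhs x) _ (fun=> z) (@circle_point R));
        [exact: cvg_cst|exact: continuous_circle_point].
    exact: (cvg_comp _ _ sk (cz t)).
  - exact: cnorm_ge0.
  - by move=> n; exact: (u_gt0 n (Ordinal (kN n))).
have := @fatou _ _ _ leb `[0%R, 1%R[ _ f.
move=> /(_ _ _ _) h; apply: (@le_trans _ _
  (limn_einf (fun n => \int[leb]_(t in `[0%R, 1%R[) f n t)%E)).
  have -> : (\int[leb]_(t in `[0%R, 1%R[) (c%:E + log_kernel (cnorm (z - circle_point t)%R)) =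
      \int[leb]_(t in `[0%R, 1%R[) limn_einf (f ^~ t))%E.
    apply: eq_integral => t; rewrite inE /= in_itv /= => t01.
    by rewrite (cvg_limn_einf_sup (f_cvg t t01)).
  apply: h => //.
    by move=> n; exact: measurable_step_function.
  move=> n t; rewrite /= in_itv /= => t01.
  by rewrite lee_fin step_functionE.
rewrite limn_einf_lim; apply: lime_le; first exact: is_cvg_einfs.
apply: nearW => n; apply: le_trans (f_int n).
by apply: ereal_inf_lbound; exists n => /=.
Qed.
End circle_potential.

(** * Energy of the uniform measure and capacity *)

Section circle_capacity.
Local Set Implicit Arguments.
Local Unset Strict Implicit.
Variable R : realType.
Local Notation C := R[i].
Local Notation leb := (@lebesgue_measure R).

Lemma measurable_circle_point :
  measurable_fun setT (@circle_point R : measurableTypeR R -> borelC R).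
Proof.
apply: (@measurability _ _ (measurableTypeR R) (borelC R) _ _ (@open C)) => // _ [U oU <-].
rewrite setTI; apply: open_measurable.
by move/continuousP: (@continuous_circle_point R); apply.
Qed.

Let X : {mfun measurableTypeR R >-> borelC R} :=
  mfun_Sub (mem_set measurable_circle_point).

Definition circle_uniform : probability (borelC R) R :=
  distribution (uniform_prob (@ltr01 R)) X.

Let ge0_integral_circle_uniform (F : borelC R -> \bar R) :
  measurable_fun setT F -> (forall w, 0 <= F w)%E ->
  (\int[circle_uniform]_w F w = \int[leb]_(t in `[0%R, 1%R[) F (circle_point t))%E.
Proof.
move=> mF F0; have mFX : measurable_fun setT (F \o X).
  by apply: measurableT_comp.
rewrite ge0_integral_distribution // integral_uniform //.
rewrite subr0 invr1 mul1e integral_itv_bndo_bndc //.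
  exact: measurable_funTS.
by move=> t; exact: F0.
Qed.

Let measurable_kernel (z : C) :
  measurable_fun setT (fun w : borelC R => log_kernel (cnorm (z - (w : C)))).
Proof.
apply: measurableT_comp; first exact: measurable_log_kernel.
apply: continuous_measurable_borelC => w.
apply: (@continuous_comp _ _ _ (fun w => z - w)); last exact: continuous_cnorm.
by apply: (@cvgB _ C _ (nbhs w) _ (fun=> z) id); [exact: cvg_cst|exact: cvg_id].
Qed.

(** The shift by c is removed from [circle_potential_shifted_le]; the subtraction is legitimate
    because the shifted integrand is nonnegative with finite integral. *)
Lemma circle_potential_le0 (z : C) :
  (\int[circle_uniform]_w log_kernel (cnorm (z - (w : C))%R) <= 0)%E.
Proof.
pose F (w : borelC R) := log_kernel (cnorm (z - (w : C))).
have mF : measurable_fun setT F by exact: measurable_kernel.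
have -> : (\int[circle_uniform]_w F w =
    \int[leb]_(t in `[0%R, 1%R[) F (circle_point t))%E.
  (* The change of variables is available for nonnegative functions, hence the passage through
     positive and negative parts. *)
  rewrite integralE [RHS]integralE.
  have mFp := measurable_funepos mF; have mFn := measurable_funeneg mF.
  rewrite (ge0_integral_circle_uniform mFp) // (ge0_integral_circle_uniform mFn) //.
  by congr (_ - _)%E; apply: eq_integral => t _; rewrite ?funeposE ?funenegE.
pose c := ln (1 + cnorm z).
have mG : measurable_fun (`[0%R, 1%R[%classic : set R) (fun t => F (circle_point t)).
  by apply: measurable_funTS; exact: (measurableT_comp mF measurable_circle_point).
have mD : measurable (`[0%R, 1%R[%classic : set R) by exact: measurable_itv.
have leb1 : leb (`[0%R, 1%R[%classic : set R) = 1%E.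
  by rewrite lebesgue_measure_itv /= lte_fin ltr01 sube0.
have cG0 t : (0 <= c%:E + F (circle_point t))%E.
  by rewrite addrC -leeBlDr // sub0e; exact/log_kernel_ge/cnorm_circle_point.
have cGc := circle_potential_shifted_le z.
have icG : leb.-integrable (`[0%R, 1%R[%classic : set R)
    (fun t => c%:E + F (circle_point t))%E.
  apply/integrableP; split; first exact: emeasurable_funD.
  under eq_integral do rewrite gee0_abs //.
  by apply: le_lt_trans cGc _; rewrite ltry.
have ic : leb.-integrable (`[0%R, 1%R[%classic : set R) (cst c%:E).
  apply/integrableP; split; first exact: measurable_cst.
  rewrite integral_cst //=; apply: (@le_lt_trans _ _ (`|c|%:E * 1)%E).
    by rewrite -leb1.
  by rewrite mule1 ltry.
have -> : (\int[leb]_(t in `[0%R, 1%R[) F (circle_point t) =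
    \int[leb]_(t in `[0%R, 1%R[) ((c%:E + F (circle_point t)) - c%:E))%E.
  by apply: eq_integral => t _; rewrite addeAC subee // add0e.
have ic1 : (\int[leb]_(t in `[0%R, 1%R[) c%:E = c%:E)%E.
  by rewrite integral_cst //= -[RHS]mule1 -leb1.
by rewrite integralB // ic1 leeBlDr // add0e.
Qed.

(** The potential is nonpositive everywhere, so its positive part vanishes and the energy is minus
    the integral of its negative part. *)
Lemma circle_uniform_energy_le0 : (log_energy circle_uniform <= 0)%E.
Proof.
rewrite /log_energy integralE.
have F0 := circle_potential_le0.
rewrite (eq_integral (cst 0%E)); last first.
  move=> z zT; rewrite (@le0_funeposE _ _ setT) // => w _; exact: F0.
rewrite integral0 sub0e oppe_le0; apply: integral_ge0 => z _.
exact: funeneg_ge0.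
Qed.

Lemma capacity_ge1 (K : set C) : measurable (K : set (borelC R)) ->
  unit_circle R `<=` K -> (1 <= capacity K)%E.
Proof.
move=> mK K1; rewrite /capacity -[leLHS]expeR0 lee_expeR leeNr oppe0.
apply: le_trans circle_uniform_energy_le0.
apply: ereal_inf_lbound; exists circle_uniform => //=.
rewrite /circle_uniform /distribution /pushforward.
rewrite (_ : X @^-1` K = setT) ?probability_setT //.
apply/seteqP; split => // t _; apply: K1.
by rewrite /unit_circle /= cnormE cnorm_circle_point.
Qed.
End circle_capacity.

(** * From regularity to the means of the logarithmic ratios *)

(** The sum telescopes to ln kap_n - ln kap_0 and is nonnegative, so an upper bound suffices: since
    exp(-e/2) < 1 <= c, eventually kap_n^(-1/n) > exp(-e/2), that is, ln kap_n / n < e/2. *)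
Lemma mean_log_ratio_cvg0 (R : realType) (kap : nat -> R) (c : \bar R) :
  (forall n, 0 < kap n) -> (forall n, kap n <= kap n.+1) -> (1 <= c)%E ->
  (fun n => (kap n `^ (- n%:R^-1))%:E) @ \oo --> c ->
  (fun n => (\sum_(1 <= k < n.+1) ln (kap k / kap k.-1)) / n%:R) @ \oo --> (0 : R).
Proof.
move=> kap0 kap_ndec c1 kapc.
have sumE n : \sum_(1 <= k < n.+1) ln (kap k / kap k.-1) = ln (kap n) - ln (kap 0%N).
  rewrite big_add1 -(telescope_sumr (fun k => ln (kap k))) //.
  by apply: eq_bigr => k _; rewrite ln_div ?posrE.
have sum0 n : 0 <= \sum_(1 <= k < n.+1) ln (kap k / kap k.-1).
  rewrite big_add1 sumr_ge0 // => k _.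
  by rewrite ln_ge0 // ler_pdivlMr // mul1r.
apply/cvgrPdist_lt => e e0; have e2 : 0 < e / 2 by rewrite divr_gt0.
have small : \forall n \near \oo, `|ln (kap 0%N)| / n%:R < e / 2.
  near=> n.
  have n0 : (0 < n)%N by near: n; exact: nbhs_infty_gt.
  rewrite ltr_pdivrMr ?ltr0n // mulrC -ltr_pdivrMr //.
  near: n; exact: nbhs_infty_gtr.
have ec : ((expR (- (e / 2)))%:E < c)%E.
  by apply: lt_le_trans c1; rewrite lte_fin expR_lt1 oppr_lt0.
have large : \forall n \near \oo, ((expR (- (e / 2)))%:E < (kap n `^ (- n%:R^-1))%:E)%E.
  exact: (kapc _ (open_ereal_gt' ec)).
near=> n.
have n0 : (0 < n)%N by near: n; exact: nbhs_infty_gt.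
rewrite sub0r normrN ger0_norm ?divr_ge0 // sumE mulrBl.
have ln_lt : ln (kap n) / n%:R < e / 2.
  have : ((expR (- (e / 2)))%:E < (kap n `^ (- n%:R^-1))%:E)%E by near: n.
  by rewrite lte_fin /powR gt_eqF // ltr_expR mulNr ltrN2 mulrC.
have : `|ln (kap 0%N)| / n%:R < e / 2 by near: n.
have := ler_norm (- ln (kap 0%N)); rewrite normrN.
rewrite -(@ler_pM2r _ n%:R^-1) ?invr_gt0 ?ltr0n // mulNr; lra.
Unshelve. all: by end_near. Qed.

(** * Distance from the quotient to 1 *)

Section ratio.
Variables (R : realType) (mu : {finite_measure set (borelC R) -> \bar R}).
Variable p : nat -> {poly R[i]}.
Hypothesis p_orthonormal : orthonormal_polynomials mu p.
Hypothesis supp_mu : supp mu `<=` closed_disk R.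

Let lead_kappa n : lead_coef (p n) = (kappa p n)%:C.
Proof.
by have [/(_ n)[_ /ltW /ger0_Im]] := p_orthonormal; rewrite /kappa; case: lead_coef => a b /= ->.
Qed.

Lemma kappa_gt0 n : 0 < kappa p n.
Proof. by have [/(_ n)[_]] := p_orthonormal; rewrite lead_kappa (ltcR 0). Qed.

Let ip (f g : {poly R[i]}) := cintegral mu (fun z => (f.[z])^*%C * g.[z]).

Lemma kappa_ndec n : kappa p n <= kappa p n.+1.
Proof.
have [sl on] := p_orthonormal.
rewrite -lecR -!lead_kappa.
apply: (@lead_coef_orthonormal_ndec _ ip (ip_addr supp_mu) (ip_scaler supp_mu)
  (ip_conj supp_mu) (ip_diag_ge0 mu) (ip_mulX_le supp_mu)) => //.
- by move=> m; exact: (sl m).1.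
- by move=> m; exact: (sl m).2.
Qed.

Lemma zpratio_bound n z : 1 < cnorm z ->
  (cnorm z - 1) ^+ 2 *
    cnorm (zpratio p n.+1 (Some z) - (kappa p n / kappa p n.+1)%:C) ^+ 2
    <= 1 - (kappa p n / kappa p n.+1) ^+ 2.
Proof.
move=> z1; have [sl on] := p_orthonormal.
have z1C : 1 < `|z| by rewrite cnormE (ltcR 1).
have := @orthonormal_ratio_bound _ ip (ip_addr supp_mu) (ip_scaler supp_mu)
  (ip_conj supp_mu) (ip_diag_ge0 mu) (ip_mulX_le supp_mu) p
  (fun m => (sl m).1) (fun m => (sl m).2) on n z z1C.
rewrite !lead_kappa !cnormE -lecR.
by rewrite !(rmorphM, rmorphB, rmorphXn, rmorph1, fmorphV).
Qed.

(** Triangle inequality through r, with |z| - 1 >= d in [zpratio_bound]. At infinity the quotient is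
    r itself and only 1 - r remains. *)
Lemma zpratio_dist (K : set (sphere R)) (d : R) n (x : sphere R)
    (r := kappa p n / kappa p n.+1) :
  0 < d -> (forall z, K (Some z) -> 1 + d <= cnorm z) -> K x ->
  cnorm (zpratio p n.+1 x - 1) <= Num.sqrt (1 - r ^+ 2) / d + (1 - r).
Proof.
move=> d0 Kd Kx.
have k1 := kappa_gt0 n; have k2 := kappa_gt0 n.+1.
have r0 : 0 < r by rewrite divr_gt0.
have r1 : r <= 1 by rewrite ler_pdivrMr // mul1r kappa_ndec.
have rN1 : cnorm (r%:C - 1) = 1 - r.
  rewrite cnormB (_ : _ - _ = (1 - r)%:C); last by rewrite rmorphB rmorph1.
  by rewrite cnorm_real ger0_norm // subr_ge0.
have -> : zpratio p n.+1 x - 1 = (zpratio p n.+1 x - r%:C) + (r%:C - 1) by ring.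
apply: le_trans (cnormD _ _) _; rewrite rN1 lerD2r.
case: x Kx => [z|] Kx; last first.
  by rewrite /= subrr cnorm_real normr0 divr_ge0 ?sqrtr_ge0 // ltW.
have zd := Kd z Kx; have z1 : 1 < cnorm z by lra.
have := zpratio_bound n z z1; rewrite -/r.
move: (cnorm (_ - r%:C)) (cnorm_ge0 (zpratio p n.+1 (Some z) - r%:C)) => w w0 hw.
rewrite ler_pdivlMr // -[w * d]ger0_norm ?mulr_ge0 ?(ltW d0) // -sqrtr_sqr.
rewrite ler_wsqrtr // exprMn mulrC; apply: le_trans hw.
by rewrite ler_wpM2r ?sqr_ge0 // ler_pXn2r ?nnegrE ?(ltW d0) ?subr_ge0 ?(ltW z1) // lerBrDl.
Qed.
End ratio.



Theorem corollary3p5 (R : realType)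
    (mu : {finite_measure set (borelC R) -> \bar R}) (p : nat -> {poly R[i]})
    (mu_compact : compact (supp mu)) (mu_infinite : infinite_set (supp mu))
    (p_orthonormal : orthonormal_polynomials mu p)
    (mu_regular : regular_on_closed_disk mu p) :
  exists N : set nat, asymptotic_density N (1 : R) /\
    forall K : set (sphere R), compact K -> K `<=` ~` (Some @` closed_disk R) ->
      {uniform K, zpratio p @ within N \oo --> (fun=> 1 : R[i])}.
Proof.
have [reg supp_disk circle_supp] := mu_regular.
have kap0 := kappa_gt0 _ _ _ p_orthonormal.
have kap_ndec := kappa_ndec _ _ _ p_orthonormal supp_disk.
have cap1 : (1 <= capacity (supp mu))%E.
  apply: capacity_ge1 circle_supp; apply: closed_measurable_borelC.
  by apply: compact_closed mu_compact; exact: norm_hausdorff.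
pose a k := ln (kappa p k / kappa p k.-1).
have a_ge0 k : 0 <= a k.
  rewrite ln_ge0 // ler_pdivlMr // mul1r.
  (* At k = 0 the predecessor is again 0, so the ratio is 1. *)
  by case: k => [|k] //=; exact: kap_ndec.
have mean0 := mean_log_ratio_cvg0 _ _ _ kap0 kap_ndec cap1 reg.
have [N [densN aN]] := density_one_cvg0 _ _ a_ge0 mean0.
exists N; split=> // K cK K_off.
have [d d0 Kd] := compact_sphere_dist cK K_off.
(* This is kappa_{k-1} / kappa_k, written so that r -> 1 follows from a -> 0 by continuity. *)
pose r k : R := expR (- a k).
pose b k : R := Num.sqrt (1 - r k ^+ 2) / d + (1 - r k).
have rN : r @ within N \oo --> (1 : R).
  rewrite -expR0 -oppr0.
  apply: (@cvg_comp _ _ _ a (fun x => expR (- x)) _ _ _ aN).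
  apply: (@continuous_comp _ _ _ -%R expR); first exact: oppr_continuous.
  exact: continuous_expR.
have bN : b @ within N \oo --> (0 : R).
  have -> : 0 = Num.sqrt (1 - 1 * 1) / d + (1 - 1) :> R.
    by rewrite mulr1 subrr sqrtr0 mul0r addr0.
  apply: cvgD; last by apply: cvgB; [exact: cvg_cst|exact: rN].
  apply: cvgMr_tmp.
  apply: (@cvg_comp _ _ _ (fun k => 1 - r k ^+ 2) Num.sqrt); last first.
    exact: sqrt_continuous.
  by apply: cvgB; [exact: cvg_cst|apply: cvgM; exact: rN].
have zb : \forall n \near within N \oo, forall x, K x -> cnorm (zpratio p n x - 1) <= b n.
  rewrite /within /= /nbhs /=.
  (* The index 0 is discarded because [zpratio_dist] is stated for successors. *)
  apply: (@filterS _ \oo _ _ _ _ (nbhs_infty_gt 0)) => -[//|n] _ _ x Kx.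
  rewrite /b /r /a /= -lnV ?posrE ?divr_gt0 //.
  rewrite lnK ?posrE ?invr_gt0 ?divr_gt0 // invf_div.
  exact: (zpratio_dist _ _ _ p_orthonormal supp_disk _ _ _ _ d0 Kd Kx).
move=> P /uniform_nbhs [E [entE EP]].
move: entE; rewrite -entourage_from_ballE => -[e /= e0 eE].
(* The radius of a ball in [R[i]] is itself a complex number; being positive, it is real. *)
have [e' e'0 ee'] : exists2 e' : R, 0 < e' & e = e'%:C.
  move: e e0 {eE} => [x y]; rewrite ltcE /= => /andP[/eqP y0 x0].
  by exists x; rewrite // y0.
have be : \forall n \near within N \oo, b n < e'.
  move/cvgrPdist_lt: bN => /(_ e' e'0); apply: filterS => n.
  by rewrite sub0r normrN; apply: le_lt_trans (ler_norm _).
apply: filterS (filterI zb be) => n [zbn bn].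
apply: EP => x Kx; apply: eE.
rewrite /= -ball_normE /= ee' distrC cnormE ltcR.
exact: le_lt_trans (zbn x Kx) bn.
Qed.
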